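(* Consider the electrical network described in the context, with generalized incidence matrix $B\in\{-1,0,1\}^{n\times m}$, link thresholds (dielectric rigidities) $V_k$, $k=0,\dots,m-1$, and current $d$ injected at node $0$, with $\bar d=[d,0,\dots,0]^\top\in\mathbb{R}^n$. Consider a sequence of characteristics $\phi^r_k$, $r=1,2,\dots$ ($k=0,\dots,m-1$), such that, for all $r$, the corresponding steady-state current distribution $\bar u^r_k$ in the links is uniquely defined. Assume that the threshold-like characteristics converge to the ideal one: for every $k$ and every $v\in\mathbb{R}$, $$\phi^r_k(v)\to\phi^{th}_k(v)\quad\text{as } r\to\infty,\qquad \phi^{th}_k(v)=\begin{cases}0 & \text{if } |v|\le V_k,\\ +\infty & \text{if } v>V_k,\\ -\infty & \text{if } v<-V_k.\end{cases}$$ Moreover, assume that the minimum path from node $0$ to node $n$ in terms of sum of dielectric rigidities $\sum_{k\in\mathcal{P}}V_k$ is unique. Let $\bar u^{th}=(\bar u^{th}_0,\dots,\bar u^{th}_{m-1})$ be the current distribution with the whole current $d$ flowing from node $0$ to node $n$ along this minimum path. Then the link current distributions $\bar u^r_k$ converge to $\bar u^{th}_k$: $$\bar u^r_k\to\bar u^{th}_k\quad\text{as } r\to\infty,\qquad k=0,\dots,m-1,$$ namely, the current distributions converge to the one with the whole current $d$ flowing along the minimum path.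
   Context: Network. $\mathcal{G}=(\mathcal{N},\mathcal{L})$ is a graph with nodes $\mathcal{N}=\{0,\dots,n\}$ and links $\mathcal{L}=\{0,\dots,m-1\}$. Node $n$ is the zero-potential ground; node $0$ is the source node. Each link is given an arbitrary direction. The matrix $B$ has one row for each of the nodes $0,\dots,n-1$ (the row of the ground node $n$ is removed) and one column per link: if link $k$ goes from node $i$ to node $j$, column $k$ has entry $1$ in row $i$, entry $-1$ in row $j$ (with no entry for node $n$) and zeros elsewhere. The graph is connected, including to the ground, so $B$ has full row rank. $V_k>0$ is the threshold voltage of link $k$. Characteristics and steady state. The characteristic function $\phi_k:\mathbb{R}\to\mathbb{R}$ of link $k$ gives the resistor current as a function of the voltage difference across the link. Standing assumption: each characteristic function is odd, monotonically increasing and locally Lipschitz, and is regarded as invertible with inverse defined on all of $\mathbb{R}$; monotonically increasing can be weakened to non-decreasing. With $\phi(w)=[\phi_0(w_0),\dots,\phi_{m-1}(w_{m-1})]^\top$ and $v\in\mathbb{R}^n$ the vector of voltages of nodes $0,\dots,n-1$ (the ground has voltage $0$), the steady-state current distribution is $\bar u=\phi(B^\top\bar v)\in\mathbb{R}^m$, where $\bar v\in\mathbb{R}^n$ satisfies $B\,\phi(B^\top\bar v)=\bar d$. Paths. Paths may traverse links in either direction irrespective of the assigned orientation; $k\in\mathcal{P}$ means that path $\mathcal{P}$ crosses link $k$. The whole current $d$ flowing along $\mathcal{P}$ means $u_k=d$ (respectively $u_k=-d$) if $\mathcal{P}$ crosses link $k$ along (respectively against) its orientation, and $u_k=0$ if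 $k\notin\mathcal{P}$. *)

(* Defs.v *)
From HB Require Import structures.
From mathcomp Require Import all_boot all_order all_algebra.
From mathcomp Require Import all_classical all_reals all_analysis.

Set Implicit Arguments.
Unset Strict Implicit.
Unset Printing Implicit Defensive.

Import Order.TTheory GRing.Theory Num.Theory.
Import numFieldNormedType.Exports.

Local Open Scope classical_set_scope.
Local Open Scope ring_scope.

(* Node [ord_max] is the zero-potential ground and node [ord0] is the source.
   Links are numbered, so parallel links are allowed, but self-loops are not. *)
Record network (n m : nat) := Network {
  src : 'I_m -> 'I_n.+1;
  tgt : 'I_m -> 'I_n.+1;
  src_neq_tgt : forall k, src k != tgt k
}.

Definition adjacent n m (G : network n m) : rel 'I_n.+1 := fun x y =>
  [exists k, ((src G k == x) && (tgt G k == y))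
          || ((src G k == y) && (tgt G k == x))].

Definition connected_network n m (G : network n m) : Prop :=
  forall x y : 'I_n.+1, connect (adjacent G) x y.

(* The row of the ground node, whose value is n, is absent: i < n. *)
Definition incidence (R : realType) n m (G : network n m) : 'M[R]_(n, m) :=
  \matrix_(i < n, k < m)
    if src G k == i :> nat then 1 else if tgt G k == i :> nat then -1 else 0.

Definition injection (R : realType) n (d : R) : 'cV[R]_n :=
  \col_(i < n) if i == 0%N :> nat then d else 0.

Definition apply_char (R : realType) m (phi : 'I_m -> R -> R) (w : 'cV[R]_m) :
    'cV[R]_m :=
  \col_(k < m) phi k (w k 0).

Definition steady_current (R : realType) n m (G : network n m)
    (phi : 'I_m -> R -> R) (d : R) (u : 'cV[R]_m) : Prop :=
  exists2 v : 'cV[R]_n,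
    incidence R G *m apply_char phi ((incidence R G)^T *m v) = injection n d
    & u = apply_char phi ((incidence R G)^T *m v).

(* Monotonicity is the weak one, and invertibility is accordingly only
   surjectivity: a (possibly multivalued) inverse is defined on all of R.
   When [f] is strictly increasing this is bijectivity. *)
Definition characteristic (R : realType) (f : R -> R) : Prop :=
  [/\ forall x, f (- x) = - f x,
      {homo f : x y / x <= y},
      [locally [lipschitz f x | x in [set: R]]]
    & forall y, exists x, f x = y].

Definition ideal_threshold (R : realType) (V v : R) : \bar R :=
  if `|v| <= V then 0%E else if V < v then +oo%E else -oo%E.

(* A link with a direction of travel; [true] is along the orientation. *)
Definition dart (m : nat) : Type := ('I_m * bool)%type.

Definition dart_from n m (G : network n m) (e : dart m) : 'I_n.+1 :=
  if e.2 then src G e.1 else tgt G e.1.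

Definition dart_to n m (G : network n m) (e : dart m) : 'I_n.+1 :=
  if e.2 then tgt G e.1 else src G e.1.

Fixpoint walk n m (G : network n m) (x : 'I_n.+1) (p : seq (dart m))
    (y : 'I_n.+1) : bool :=
  if p is e :: p' then (dart_from G e == x) && walk G (dart_to G e) p' y
  else x == y.

(* Paths do not visit a node twice. *)
Definition simple_path n m (G : network n m) (x : 'I_n.+1) (p : seq (dart m))
    (y : 'I_n.+1) : bool :=
  walk G x p y && uniq (x :: map (dart_to G) p).

Definition rigidity (R : realType) m (V : 'I_m -> R) (p : seq (dart m)) : R :=
  \sum_(k < m | k \in map fst p) V k.

Definition minimum_path (R : realType) n m (G : network n m) (V : 'I_m -> R)
    (p : seq (dart m)) : Prop :=
  simple_path G ord0 p ord_max /\
  forall q, simple_path G ord0 q ord_max -> rigidity V p <= rigidity V q.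

Definition path_current (R : realType) m (p : seq (dart m)) (d : R) :
    'cV[R]_m :=
  \col_(k < m)
    if (k, true) \in p then d else if (k, false) \in p then - d else 0.

(* Main.v *)
(* By oddness take [d >= 0]. Current flows from higher to lower potential, so
   no link carries more than [d]. For large [r], a small [eta] bounds every
   [phi r k (V k)]. By conservation across cuts, a link with current above
   [m * eta] lies on a walk from source to ground all of whose links carry more
   than [eta]; the potential decreases along it, so it is a simple path [q],
   and every link of [q] is above its threshold: the source potential is at
   least the rigidity of [q]. Along the minimum path [p], links carry at most
   [d], hence have voltage at most [V k + eps], and the source potential is at
   most the rigidity of [p] plus [size p * eps]. By the gap between [p] and the
   other paths, [q = p] once [eps] is small. Hence the currents off [p] tend to
   0, and conservation across the cuts that separate prefixes of [p] forces
   current [d] on [p]. *)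
Require Import Defs.
From HB Require Import structures.
From mathcomp Require Import all_boot all_order all_algebra.
From mathcomp Require Import all_classical all_reals all_analysis.
From mathcomp Require Import ring lra.

Set Implicit Arguments.
Unset Strict Implicit.
Unset Printing Implicit Defensive.

Import Order.TTheory GRing.Theory Num.Theory.
Import numFieldNormedType.Exports.

Local Open Scope classical_set_scope.
Local Open Scope ring_scope.

(** * Currents and voltage drops along darts and walks *)

Definition along (R : realType) m (f : 'I_m -> R) (e : dart m) : R :=
  if e.2 then f e.1 else - f e.1.

Definition drop_along (R : realType) n m (G : network n m) (x : 'I_n.+1 -> R)
    (e : dart m) : R :=
  x (dart_from G e) - x (dart_to G e).

(* Kirchhoff's law, tested against arbitrary potentials [y]. *)
Definition conserved (R : realType) n m (G : network n m) (d : R)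
    (f : 'I_m -> R) : Prop :=
  forall y : 'I_n.+1 -> R,
    \sum_k f k * (y (src G k) - y (tgt G k)) = d * (y ord0 - y ord_max).

Definition downhill (R : realType) n m (G : network n m) (x : 'I_n.+1 -> R)
    (f : 'I_m -> R) : Prop :=
  forall e, 0 < along f e -> 0 < drop_along G x e.

Lemma same_link n m (G : network n m) (e e' : dart m) :
  e'.1 = e.1 -> e' = e \/ dart_to G e' = dart_from G e.
Proof.
case: e e' => [k b] [k' b'] /= ->.
by case: b; case: b'; by [left | right].
Qed.

Lemma walk_cat n m (G : network n m) a p q b :
  walk G a (p ++ q) b =
  walk G a p (last a (map (dart_to G) p)) &&
  walk G (last a (map (dart_to G) p)) q b.
Proof. by elim: p a => [|e p IHp] a /=; rewrite ?eqxx // IHp andbA. Qed.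

Lemma walk_last n m (G : network n m) a p b :
  walk G a p b -> last a (map (dart_to G) p) = b.
Proof. by elim: p a => [|e p IHp] a /= => [/eqP//|/andP[_ /IHp]]. Qed.

Lemma mem_dart_from n m (G : network n m) a p b e :
  walk G a p b -> e \in p -> dart_from G e \in a :: map (dart_to G) p.
Proof.
elim: p a => [|e' p IHp] a //= /andP[/eqP ea w].
rewrite inE => /predU1P[->|ep]; first by rewrite ea mem_head.
by rewrite inE (IHp _ w ep) orbT.
Qed.

(** A second traversal of a link would either repeat its end node or run back to its start node. *)
Lemma simple_path_uniq_links n m (G : network n m) a p b :
  simple_path G a p b -> uniq (map fst p).
Proof.
elim: p a => [|e p IHp] a //= /andP[/= /andP[/eqP ea w] /andP[anp up]].
rewrite (IHp (dart_to G e)) ?andbT; last by rewrite /simple_path w.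
apply/mapP => -[e' e'p e1].
have [e'e|e'a] := same_link G (esym e1).
  by move: up; rewrite /= -{1}e'e map_f.
by move: anp; rewrite inE -ea -e'a (map_f _ e'p) orbT.
Qed.

Lemma along_drop (R : realType) n m (G : network n m) (f : 'I_m -> R)
    (y : 'I_n.+1 -> R) (e : dart m) :
  f e.1 * (y (src G e.1) - y (tgt G e.1)) = along f e * drop_along G y e.
Proof. by case: e => k [] //=; rewrite /along /drop_along /=; ring. Qed.

Lemma ler_norm_along (R : realType) m (f : 'I_m -> R) (a : R) :
  (forall e, along f e <= a) -> forall k, `|f k| <= a.
Proof.
move=> fa k; rewrite ler_norml.
by have := fa (k, true); have := fa (k, false); rewrite /along /=; lra.
Qed.

Lemma sum_drop (R : realType) n m (G : network n m) (x : 'I_n.+1 -> R) a p b :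
  walk G a p b -> \sum_(e <- p) drop_along G x e = x a - x b.
Proof.
elim: p a => [|e p IHp] a /= => [/eqP->|/andP[/eqP ea /IHp IH]].
  by rewrite big_nil subrr.
by rewrite big_cons IH /drop_along ea; ring.
Qed.

(** The potential falls strictly along the walk, so no node recurs; the induction also carries that
    later nodes lie below [a]. *)
Lemma downhill_walk_uniq (R : realType) n m (G : network n m)
    (x : 'I_n.+1 -> R) a p b :
  walk G a p b -> (forall e, e \in p -> 0 < drop_along G x e) ->
  uniq (a :: map (dart_to G) p).
Proof.
move=> w dp.
suff [] : (forall i, i \in map (dart_to G) p -> x i < x a) /\
          uniq (a :: map (dart_to G) p) by [].
elim: p a w dp => [|e p IHp] a //= /andP[/eqP ea w] dp.
have ep : x (dart_to G e) < x a.
  by have := dp e (mem_head _ _); rewrite /drop_along ea; lra.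
have [|xp /= up] := IHp _ w.
  by move=> e' e'p; apply: dp; rewrite inE e'p orbT.
have xa i : i \in dart_to G e :: map (dart_to G) p -> x i < x a.
  by rewrite inE => /predU1P[->//|/xp /lt_trans]; apply.
by split=> //; rewrite up andbT; apply/negP => /xa; rewrite ltxx.
Qed.

Lemma sum_links (R : realType) m (V : 'I_m -> R) (p : seq (dart m)) :
  uniq (map fst p) -> \sum_(e <- p) V e.1 = rigidity V p.
Proof.
move=> up; rewrite -[LHS](big_map fst xpredT V) /rigidity.
by rewrite big_uniq.
Qed.

(** The sum counts a link once per traversal, [rigidity] only once. *)
Lemma rigidity_le_sum (R : realType) m (V : 'I_m -> R) (p : seq (dart m)) :
  (forall k, 0 <= V k) -> rigidity V p <= \sum_(e <- p) V e.1.
Proof.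
move=> V0; rewrite -[leRHS](big_map fst xpredT V) /rigidity.
rewrite (eq_bigl (mem (undup (map fst p)))); last first.
  by move=> k; rewrite /= mem_undup.
rewrite -big_uniq ?undup_uniq //=.
elim: (map fst p) => [|k s IHs] //=; rewrite [leRHS]big_cons.
by case: ifP => _; rewrite ?big_cons; have := V0 k; lra.
Qed.

(** * Estimates for conserved downhill currents *)

(** Take the cut given by the superlevel set of [x] at the start of [e]. All current across it flows
    outward, so [e] carries at most the total, which is at most [d]. *)
Lemma along_le_injection (R : realType) n m (G : network n m) (d : R) f
    (x : 'I_n.+1 -> R) :
  0 <= d -> conserved G d f -> downhill G x f -> forall e, along f e <= d.
Proof.
move=> d0 fd fx e; have [fe|/fx xe] := lerP (along f e) 0.
  exact: le_trans d0.
pose y i : R := if x (dart_from G e) <= x i then 1 else 0.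
have y01 i : 0 <= y i <= 1 by rewrite /y; case: ifP; lra.
have yx i j : x i <= x j -> y i <= y j.
  rewrite /y => xij; case: (lerP _ (x i)) => [/le_trans->//|_].
  by case: ifP; lra.
have term k : 0 <= f k * (y (src G k) - y (tgt G k)).
  have [fk|fk|->] := ltrgtP (f k) 0; last by rewrite mul0r.
    have := fx (k, false); rewrite /along /drop_along /= => h.
    by rewrite -mulrNN mulr_ge0 ?opprB ?subr_ge0 ?yx //; lra.
  have := fx (k, true); rewrite /along /drop_along /= => h.
  by rewrite mulr_ge0 ?subr_ge0 ?yx //; lra.
have := fd y; rewrite (bigD1 e.1) //= along_drop.
have -> : drop_along G y e = 1.
  rewrite /drop_along /y lexx lt_geF ?subr0 //.
  by move: xe; rewrite /drop_along; lra.
have : 0 <= \sum_(k | k != e.1) f k * (y (src G k) - y (tgt G k)).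
  exact: sumr_ge0.
have : d * (y ord0 - y ord_max) <= d * 1.
  by apply: ler_wpM2l => //; have := y01 ord0; have := y01 ord_max; lra.
lra.
Qed.

(* The set [S] receives more through [e] than it can let out through darts
   carrying at most [eta], so it must contain the sink and miss the source. *)
Lemma closed_set_sink (R : realType) n m (G : network n m) (d eta : R) f
    (S : pred 'I_n.+1) (e : dart m) :
  0 <= d -> 0 <= eta -> conserved G d f ->
  (forall e, S (dart_from G e) -> eta < along f e -> S (dart_to G e)) ->
  ~~ S (dart_from G e) -> S (dart_to G e) -> m%:R * eta < along f e ->
  S ord_max && ~~ S ord0.
Proof.
move=> d0 eta0 fd Sc eS Se fe.
pose y i : R := if S i then 1 else 0.
have y01 i : 0 <= y i <= 1 by rewrite /y; case: (S i); lra.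
have term k : f k * (y (src G k) - y (tgt G k)) <= eta.
  rewrite /y; case Ss: (S (src G k)); case St: (S (tgt G k)); try lra.
    rewrite subr0 mulr1 leNgt; apply/negP => /(Sc (k, true) Ss) /=.
    by rewrite /dart_to /= St.
  rewrite sub0r mulrN1 leNgt; apply/negP => /(Sc (k, false) St) /=.
  by rewrite /dart_to /= Ss.
(* Entering [S], the dart [e] contributes less than [- (m%:R * eta)]; each other link adds at most
   [eta]. *)
have : d * (y ord0 - y ord_max) < 0.
  rewrite -fd (bigD1 e.1) //= along_drop.
  have -> : drop_along G y e = -1 by rewrite /drop_along /y Se (negbTE eS); lra.
  apply: (@le_lt_trans _ _ (- along f e + \sum_(k < m) eta)).
    rewrite mulrN1 lerD2l [leRHS](bigD1 e.1) //= -[leLHS]add0r lerD //.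
    exact: ler_sum.
  by rewrite sumr_const card_ord -mulr_natl; lra.
have := y01 ord0; have := y01 ord_max; rewrite /y.
by case: (S ord0); case: (S ord_max) => //=; nra.
Qed.

Definition heavy (R : realType) n m (G : network n m) (f : 'I_m -> R)
    (eta : R) : rel 'I_n.+1 := fun a b =>
  [exists e : 'I_m * bool,
     [&& dart_from G e == a, dart_to G e == b & eta < along f e]].

Lemma connect_heavy (R : realType) n m (G : network n m) (f : 'I_m -> R)
    (eta : R) a b :
  connect (heavy G f eta) a b ->
  exists2 q, walk G a q b & forall e, e \in q -> eta < along f e.
Proof.
move=> /connectP[s]; elim: s a => [|c s IHs] a /=.
  by move=> _ ->; exists [::] => //=.
move=> /andP[/existsP[e /and3P[ea ec fe]] sp /(IHs _ sp)[q w fq]].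
exists (e :: q); first by rewrite /= ea (eqP ec).
by move=> e'; rewrite inE => /predU1P[->//|/fq].
Qed.

(** [closed_set_sink] serves twice: for the nodes that heavy darts reach from the end of [e], and
    for the nodes from which they do not reach its start. The two walks joined by [e] form a simple
    path because the potential decreases. *)
Lemma heavy_dart_on_walk (R : realType) n m (G : network n m) (d eta : R) f
    (x : 'I_n.+1 -> R) (e : dart m) :
  (0 < m)%N -> 0 <= d -> 0 <= eta -> conserved G d f -> downhill G x f ->
  m%:R * eta < along f e ->
  exists q, [/\ simple_path G ord0 q ord_max, e \in q &
                forall e', e' \in q -> eta < along f e'].
Proof.
move=> m0 d0 eta0 fd fx fe.
have fe_eta : eta < along f e.
  by apply: le_lt_trans fe; rewrite ler_peMl // ler1n.
have heavy_e e' : eta < along f e' ->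
    heavy G f eta (dart_from G e') (dart_to G e').
  by move=> fe'; apply/existsP; exists e'; rewrite !eqxx.
have downhill_q (q : seq (dart m)) :
    (forall e', e' \in q -> eta < along f e') ->
    forall e', e' \in q -> 0 < drop_along G x e'.
  by move=> fq e' /fq fe'; apply: fx; exact: le_lt_trans fe'.
(* A heavy walk from the end of [e] back to its start never climbs, while [e] strictly descends. *)
have acyclic : ~~ connect (heavy G f eta) (dart_to G e) (dart_from G e).
  apply/negP => /connect_heavy[q /(sum_drop x) sq /downhill_q xq].
  have : 0 <= \sum_(e <- q) drop_along G x e.
    by rewrite big_seq sumr_ge0 // => e' /xq /ltW.
  by have := fx e (le_lt_trans eta0 fe_eta); rewrite sq /drop_along; lra.
have [q2 w2 f2] : exists2 q, walk G (dart_to G e) q ord_max &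
    forall e', e' \in q -> eta < along f e'.
  apply: connect_heavy.
  suff /andP[] : connect (heavy G f eta) (dart_to G e) ord_max &&
      ~~ connect (heavy G f eta) (dart_to G e) ord0 by [].
  apply: (closed_set_sink (S := connect (heavy G f eta) (dart_to G e)) d0 eta0
    fd _ acyclic (connect0 _ _) fe) => e' ee' fe'.
  exact: connect_trans ee' (connect1 (heavy_e _ fe')).
have [q1 w1 f1] : exists2 q, walk G ord0 q (dart_from G e) &
    forall e', e' \in q -> eta < along f e'.
  apply: connect_heavy.
  pose S i := ~~ connect (heavy G f eta) i (dart_from G e).
  suff /andP[_] : S ord_max && ~~ S ord0 by rewrite negbK.
  have eS : ~~ S (dart_from G e) by rewrite /S negbK connect0.
  apply: (closed_set_sink d0 eta0 fd _ eS acyclic fe) => e' ee' fe'.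
  apply: contra ee' => te'.
  apply: connect_trans te'.
  exact/connect1/heavy_e.
exists (q1 ++ e :: q2).
have fq e' : e' \in q1 ++ e :: q2 -> eta < along f e'.
  by rewrite mem_cat inE => /or3P[/f1//|/eqP->//|/f2].
have w : walk G ord0 (q1 ++ e :: q2) ord_max.
  by rewrite walk_cat (walk_last w1) w1 /= eqxx.
split=> //; last by rewrite mem_cat mem_head orbT.
rewrite /simple_path w /=; apply: (downhill_walk_uniq (x := x) w).
exact: downhill_q.
Qed.

(** Otherwise [e] lies on a heavy path [q] other than [p]. The voltage from source to ground is at
    least [rigidity V q] when summed along [q], and at most [rigidity V p + (size p)%:R * eps] along
    [p], against the gap. *)
Lemma off_path_small (R : realType) n m (G : network n m) (V : 'I_m -> R)
    (d eta eps : R) f (x : 'I_n.+1 -> R) p (e : dart m) :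
  (forall k, 0 <= V k) -> 0 <= d -> 0 <= eta ->
  conserved G d f -> downhill G x f ->
  (forall e, eta < along f e -> V e.1 <= drop_along G x e) ->
  (forall e, along f e <= d -> drop_along G x e <= V e.1 + eps) ->
  simple_path G ord0 p ord_max ->
  (forall q, simple_path G ord0 q ord_max -> q <> p ->
     rigidity V p + (size p)%:R * eps < rigidity V q) ->
  e.1 \notin map fst p -> along f e <= m%:R * eta.
Proof.
move=> V0 d0 eta0 fd fx lo hi sp gap ep; rewrite leNgt; apply/negP => fe.
have m0 : (0 < m)%N := leq_ltn_trans (leq0n _) (ltn_ord e.1).
have [q [sq eq fq]] := heavy_dart_on_walk m0 d0 eta0 fd fx fe.
have /gap : q <> p by move=> qp; move: ep; rewrite -qp map_f.
move=> /(_ sq); apply/negP; rewrite -leNgt.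
have [/andP[wp _] /andP[wq _]] := (sp, sq).
apply: le_trans (rigidity_le_sum q V0) _.
have : \sum_(e <- q) V e.1 <= x ord0 - x ord_max.
  by rewrite -(sum_drop x wq) big_seq [leRHS]big_seq ler_sum // => e' /fq /lo.
move=> /le_trans; apply.
rewrite -(sum_drop x wp) -(sum_links _ (simple_path_uniq_links sp)).
have -> : (size p)%:R * eps = \sum_(e <- p) eps.
  by rewrite big_const_seq count_predT -Monoid.iteropE mulr_natl.
rewrite -big_split ler_sum //= => e' _; apply: hi.
exact: along_le_injection fd fx _.
Qed.

(** No other link of [p] crosses the cut around the nodes of [p] up to the start of [e], so [e]
    carries [d] up to off-path currents. *)
Lemma on_path_close (R : realType) n m (G : network n m) (d delta : R) f p :
  conserved G d f -> simple_path G ord0 p ord_max ->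
  (forall k, k \notin map fst p -> `|f k| <= delta) -> 0 <= delta ->
  forall e, e \in p -> `|along f e - d| <= m%:R * delta.
Proof.
move=> fd sp off delta0 e ep.
case/splitPr: ep sp off => p1 p2 /andP[w u] off.
move: w; rewrite walk_cat /=; set c := last _ _ => /and3P[w1 /eqP ec w2].
pose S := ord0 :: map (dart_to G) p1.
pose y i : R := if i \in S then 1 else 0.
(* Simplicity keeps the nodes after [e] out of [S]. *)
move: u; rewrite map_cat -cat_cons -/S cat_uniq => /and3P[_ /hasPn /= S2 _].
have y2 i : i \in dart_to G e :: map (dart_to G) p2 -> y i = 0.
  by move=> /S2 /negbTE iS; rewrite /y iS.
have y1 i : i \in S -> y i = 1 by rewrite /y => ->.
have y01 i : 0 <= y i <= 1 by rewrite /y; case: (i \in S); lra.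
have := fd y; rewrite (bigD1 e.1) //= along_drop.
have -> : drop_along G y e = 1.
  by rewrite /drop_along (y2 _ (mem_head _ _)) subr0 y1 // ec mem_last.
rewrite (y1 ord0) ?mem_head // (y2 ord_max); last first.
  by rewrite -(walk_last w2) mem_last.
rewrite subr0 !mulr1 => <-; rewrite opprD addNKr normrN.
apply: le_trans (ler_norm_sum _ _ _) _.
apply: (@le_trans _ _ (\sum_(k < m) delta)); last first.
  by rewrite sumr_const card_ord mulr_natl.
rewrite [leRHS](bigD1 e.1) //= -[leLHS]add0r lerD // ler_sum // => k ke.
case kp: (k \in map fst (p1 ++ e :: p2)); last first.
  have := off k (negbT kp); have := y01 (src G k); have := y01 (tgt G k).
  rewrite normrM => ? ? ?; rewrite -[leRHS]mulr1 ler_pM //.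
  by rewrite ler_norml; lra.
suff -> : f k * (y (src G k) - y (tgt G k)) = 0 by rewrite normr0.
move: kp => /mapP[e' e'p ke']; rewrite ke' along_drop.
move: e'p; rewrite mem_cat inE => /or3P[e'p|/eqP e'e|e'p].
- rewrite /drop_along !y1 ?subrr ?mulr0 //; last exact: mem_dart_from w1 e'p.
  by rewrite inE map_f ?orbT.
- by move: ke; rewrite ke' e'e eqxx.
- rewrite /drop_along !y2 ?subrr ?mulr0 //; last exact: mem_dart_from w2 e'p.
  by rewrite inE map_f ?orbT.
Qed.

(** * From the incidence matrix to node potentials *)

(** The ground row can be restored because [y] vanishes there; then only the two distinct ends of
    the link contribute. *)
Lemma incidence_tr_sum (R : realType) n m (G : network n m)
    (y : 'I_n.+1 -> R) (k : 'I_m) : y ord_max = 0 ->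
  \sum_i incidence R G i k * y (lift ord_max i) = y (src G k) - y (tgt G k).
Proof.
move=> y0.
pose b (i : 'I_n.+1) : R :=
  if src G k == i then 1 else if tgt G k == i then -1 else 0.
have -> : \sum_i incidence R G i k * y (lift ord_max i) = \sum_i b i * y i.
  rewrite big_ord_recr /= y0 mulr0 addr0; apply: eq_bigr => i _.
  have -> : widen_ord (leqnSn n) i = lift ord_max i.
    by apply: ord_inj; rewrite lift_max.
  by rewrite mxE /b -!(inj_eq (@ord_inj _)) lift_max.
have st := src_neq_tgt G k.
rewrite (bigD1 (src G k)) //= (bigD1 (tgt G k)) 1?eq_sym //= big1 ?addr0.
  by rewrite /b !eqxx (negbTE st) mul1r mulN1r.
move=> i /andP[si ti].
by rewrite /b eq_sym (negbTE si) eq_sym (negbTE ti) mul0r.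
Qed.

Lemma steady_current_potential (R : realType) n m (G : network n m)
    (phi : 'I_m -> R -> R) (d : R) (u : 'cV[R]_m) :
  (0 < n)%N -> steady_current G phi d u ->
  exists2 x : 'I_n.+1 -> R, conserved G d (fun k => u k 0) &
    forall k, u k 0 = phi k (x (src G k) - x (tgt G k)).
Proof.
move=> n0 [v Bu uE]; rewrite -uE in Bu.
(* [unlift] gives [None] exactly at the ground, which thus gets potential 0. *)
pose x (i : 'I_n.+1) : R := oapp (fun j => v j 0) 0 (unlift ord_max i).
exists x => [y|k]; last first.
  rewrite uE mxE -incidence_tr_sum ?/x ?unlift_none // mxE.
  by congr (phi k _); apply: eq_bigr => i _; rewrite liftK mxE.
(* The shift makes the test potential vanish at the ground and changes no difference. *)
pose z i := y i - y ord_max.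
have zE k : y (src G k) - y (tgt G k) = z (src G k) - z (tgt G k).
  by rewrite /z; ring.
under eq_bigr do
  rewrite zE -incidence_tr_sum ?[z ord_max]subrr // mulr_sumr.
rewrite exchange_big /= (bigD1 (Ordinal n0)) //= [X in _ + X]big1 => [|i i0].
  transitivity ((injection n d) (Ordinal n0) 0 * z ord0).
    rewrite -Bu mxE mulr_suml addr0; apply: eq_bigr => k _.
    have -> : lift ord_max (Ordinal n0) = ord0.
      by apply: ord_inj; rewrite lift_max.
    by ring.
  by rewrite mxE.
transitivity ((injection n d) i 0 * z (lift ord_max i)).
  by rewrite -Bu mxE mulr_suml; apply: eq_bigr => k _; ring.
move: i0; rewrite mxE -(inj_eq (@ord_inj _)) => /negbTE /= ->.
by rewrite mul0r.
Qed.

(** Serves to reduce negative [d] to the nonnegative case. *)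
Lemma steady_currentN (R : realType) n m (G : network n m)
    (phi : 'I_m -> R -> R) (d : R) (u : 'cV[R]_m) :
  (forall k w, phi k (- w) = - phi k w) ->
  steady_current G phi d u -> steady_current G phi (- d) (- u).
Proof.
move=> phiN [v Bu uE].
have phiN' w : apply_char phi (- w) = - apply_char phi w.
  by apply/colP => k; rewrite !mxE phiN.
exists (- v); rewrite mulmxN phiN' -?uE // mulmxN uE Bu.
by apply/colP => i; rewrite !mxE; case: ifP; rewrite ?oppr0.
Qed.

Lemma path_currentN (R : realType) m (p : seq (dart m)) (d : R) :
  path_current p (- d) = - path_current p d.
Proof.
apply/colP => k; rewrite !mxE.
by case: ifP => // _; case: ifP; rewrite ?oppr0.
Qed.

(** * The rigidity gap, error bounds and convergence *)

(* Finitely many sets of links occur, hence the gap. *)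
Lemma rigidity_gap (R : realType) m (V : 'I_m -> R) (a : R) :
  exists2 g : R, 0 < g &
    forall q, a < rigidity V q -> a + g <= rigidity V q.
Proof.
pose s (A : {set 'I_m}) := \sum_(k in A) V k.
(* The default [1] keeps [g] positive when no set exceeds [a]. *)
exists (\big[Num.min/1]_(A | a < s A) (s A - a)).
  by apply: lt_bigmin => // A; rewrite subr_gt0.
move=> q aq.
have qE : rigidity V q = s [set k in map fst q]%SET.
  by apply: eq_bigl => k; rewrite inE.
rewrite qE in aq *; rewrite addrC -lerBrDr.
exact: (bigmin_le_cond 1 (fun A => s A - a)).
Qed.

Lemma steady_current_close (R : realType) n m (G : network n m)
    (V : 'I_m -> R) (phi : 'I_m -> R -> R) (d eta delta eps : R)
    (u : 'cV[R]_m) p :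
  (0 < n)%N -> (forall k, 0 <= V k) -> 0 <= d -> 0 <= eta ->
  (forall k w, phi k (- w) = - phi k w) ->
  (forall k, {homo phi k : v w / v <= w}) ->
  (forall k, phi k (V k) <= eta) -> (forall k, d < phi k (V k + eps)) ->
  steady_current G phi d u ->
  simple_path G ord0 p ord_max ->
  (forall q, simple_path G ord0 q ord_max -> q <> p ->
     rigidity V p + (size p)%:R * eps < rigidity V q) ->
  m%:R * eta <= delta -> delta <= m%:R * delta ->
  forall k, `|path_current p d k 0 - u k 0| <= m%:R * delta.
Proof.
move=> n0 V0 d0 eta0 phiN phi_homo lo hi.
move=> /(steady_current_potential n0)[x ux uE] sp gap eta_delta delta_le k.
set f := fun k => u k 0 in ux.
have fE e : along f e = phi e.1 (drop_along G x e).
  case: e => i []; rewrite /along /drop_along /dart_from /dart_to /f /= uE //.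
  by rewrite -phiN opprB.
(* A characteristic may be flat, so voltages are recovered from currents only through strict
   inequalities. *)
have drop_lt a e : phi e.1 a < along f e -> a < drop_along G x e.
  rewrite fE => ltf; rewrite ltNge; apply/negP => /(phi_homo e.1).
  by rewrite leNgt ltf.
have lt_drop a e : along f e < phi e.1 a -> drop_along G x e < a.
  rewrite fE => ltf; rewrite ltNge; apply/negP => /(phi_homo e.1).
  by rewrite leNgt ltf.
have phi0 i : phi i 0 = 0 by have := phiN i 0; rewrite oppr0; lra.
have fx : downhill G x f by move=> e fe; apply: drop_lt; rewrite phi0.
have off i : i \notin map fst p -> `|f i| <= delta.
  move=> ip; have ae e : e.1 \notin map fst p -> along f e <= delta.
    move=> ep; apply: le_trans eta_delta.
    apply: (off_path_small (eps := eps) V0 d0 eta0 ux fx _ _ sp gap ep) => e'.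
      by move=> fe'; apply/ltW/drop_lt/(le_lt_trans (lo _)).
    by move=> fe'; apply/ltW/lt_drop/(le_lt_trans fe')/hi.
  have := ae (i, true) ip; have := ae (i, false) ip.
  by rewrite /along /= ler_norml; lra.
have delta0 : 0 <= delta.
  by apply: le_trans eta_delta; rewrite mulr_ge0.
have on := on_path_close ux sp off delta0.
rewrite mxE; case: ifPn => [kp|kp]; first by rewrite distrC; exact: on kp.
case: ifPn => [kn|kn].
  by have := on _ kn; rewrite /along /= addrC.
rewrite sub0r normrN; apply: le_trans (off k _) delta_le.
apply/mapP => -[[i b] ep /= ki]; move: ep; rewrite -ki.
by case: b; apply/negP.
Qed.

Lemma steady_current_cvg (R : realType) n m (G : network n m)
    (V : 'I_m -> R) (phi : nat -> 'I_m -> R -> R) (d : R)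
    (u : nat -> 'cV[R]_m) p :
  (0 < n)%N -> (forall k, 0 < V k) -> 0 <= d ->
  (forall r k, characteristic (phi r k)) ->
  (forall k v, (phi r k v)%:E @[r --> \oo] --> ideal_threshold (V k) v) ->
  (forall r, steady_current G (phi r) d (u r)) ->
  minimum_path G V p -> (forall q, minimum_path G V q -> q = p) ->
  forall k, u r k 0 @[r --> \oo] --> path_current p d k 0.
Proof.
move=> n0 V0 d0 phi_char phi_cvg us [sp p_min] p_unique k.
apply/cvgrPdist_le => e e0.
have [g g0 gP] := rigidity_gap V (rigidity V p).
have m1 : (1 <= m)%N := leq_ltn_trans (leq0n _) (ltn_ord k).
have mR : 0 < m%:R :> R by rewrite ltr0n.
(* Off-path currents are bounded by [m%:R * eta], which is [delta], and the error on [p] by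
   [m%:R * delta], which is [e]. *)
pose delta := e / m%:R; pose eta := delta / m%:R.
have eta0 : 0 < eta by rewrite !divr_gt0.
(* The successor keeps [(size p)%:R * eps] strictly below [g]. *)
pose eps := g / (size p).+1%:R.
have eps0 : 0 < eps by rewrite divr_gt0.
have gap q : simple_path G ord0 q ord_max -> q <> p ->
    rigidity V p + (size p)%:R * eps < rigidity V q.
  move=> sq qp; apply: (@lt_le_trans _ _ (rigidity V p + g)).
    rewrite ltrD2l mulrC /eps mulrAC ltr_pdivrMr // ltr_pM2l // ltr_nat.
    exact: ltnSn.
  (* A path exactly as rigid as [p] would be minimal too, hence equal to [p]. *)
  apply: gP; rewrite lt_neqAle p_min // andbT; apply/eqP => pq.
  by apply: qp; apply: p_unique; split=> // q' /p_min; rewrite pq.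
(* The ideal characteristic is 0 at [V i] itself and infinite just above; finitely many links share
   one bound on [r]. *)
have lo : \forall r \near \oo, forall k, phi r k (V k) <= eta.
  apply: filter_forall => i.
  have := phi_cvg i (V i); rewrite /ideal_threshold.
  rewrite ger0_norm ?lexx; last exact: ltW.
  move=> /fine_cvg/cvgrPdist_le/(_ _ eta0); apply: filterS => r /=.
  by rewrite sub0r normrN => /ler_normlW.
have hi : \forall r \near \oo, forall k, d < phi r k (V k + eps).
  apply: filter_forall => i.
  have := phi_cvg i (V i + eps); rewrite /ideal_threshold ltrDl eps0.
  have Ve : V i < `|V i + eps|.
    by apply: lt_le_trans (ler_norm _); rewrite ltrDl.
  rewrite leNgt Ve /= => /cvgeyPgt/(_ d); apply: filterS => r.
  by rewrite lte_fin.
apply: filterS2 lo hi => r lo hi.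
have -> : e = m%:R * delta by rewrite /delta mulrC divfK ?gt_eqF.
apply: (steady_current_close n0 _ d0 (ltW eta0) _ _ lo hi (us r) sp gap).
- by move=> i; exact: ltW.
- by move=> i w; have [] := phi_char r i.
- by move=> i; have [] := phi_char r i.
- by rewrite /eta mulrC divfK ?gt_eqF.
- by rewrite ler_peMl ?ler1n // divr_ge0 ?ltW.
Qed.

Theorem theorem1 (R : realType) (n m : nat) (n_gt0 : (0 < n)%N)
    (G : network n m) (G_connected : connected_network G)
    (V : 'I_m -> R) (V_gt0 : forall k, 0 < V k) (d : R)
    (phi : nat -> 'I_m -> R -> R)
    (phi_char : forall r k, characteristic (phi r k))
    (u_unique : forall r, exists! u, steady_current G (phi r) d u)
    (phi_to_ideal : forall k v,
       (phi r k v)%:E @[r --> \oo] --> ideal_threshold (V k) v)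
    (min_unique : exists! p, minimum_path G V p)
    (u : nat -> 'cV[R]_m)
    (u_steady : forall r, steady_current G (phi r) d (u r))
    (p : seq (dart m)) (p_min : minimum_path G V p) :
  forall k, u r k 0 @[r --> \oo] --> path_current p d k 0.
Proof.
have p_unique q : minimum_path G V q -> q = p.
  by move: min_unique => [q' [_ qq']] /qq' <-; exact: qq'.
move=> k; have [d0|d0] := lerP 0 d.
  exact: (steady_current_cvg (k := k) n_gt0 V_gt0 d0 phi_char phi_to_ideal
    u_steady p_min p_unique).
(* For negative [d], the currents [- u r] are steady for [- d]; negating their limit gives the
   claim. *)
have Nd0 : 0 <= - d by rewrite oppr_ge0 ltW.
have Nu_steady r : steady_current G (phi r) (- d) (- u r).
  by apply: steady_currentN => // i w; have [] := phi_char r i.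
have := steady_current_cvg (k := k) n_gt0 V_gt0 Nd0 phi_char phi_to_ideal
  Nu_steady p_min p_unique.
move=> /cvgN; rewrite path_currentN mxE opprK.
suff -> : (fun r => u r k 0) = \- (fun r => (- u r) k 0) by [].
by apply/funext => r /=; rewrite mxE opprK.
Qed.
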